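(* Suppose (A1)–(A5) hold. Let $u\in\mathcal{U}^+(\mathbb{T}^d\times I)$ be a viscosity subsolution and $v\in\mathcal{U}^-(\mathbb{T}^d\times I)$ a viscosity supersolution of $$F(x,Dw(x,\xi),\xi)+\int_I k(\xi,\eta)\big(w(x,\xi)-w(x,\eta)\big)\,d\eta=f(x,\xi)\quad\text{in }\mathbb{T}^d\times I,$$ and assume $u$ and $-v$ are bounded above on $\mathbb{T}^d\times I$. If $u\le v$ on $\mathcal{Z}$, then $u\le v$ on $\mathbb{T}^d\times I$.
   Context: $I\subset\mathbb{R}$ finite interval with $|I|=1$; $k:I\times I\to\mathbb{R}$ Borel measurable with $0<k_0\le k\le k_1$. $F\in C(\mathbb{T}^d\times\mathbb{R}^d)\otimes\mathcal{B}(I)$ with $F(\cdot,p,\cdot)$ bounded for each $p$; $f\in C(\mathbb{T}^d)\otimes\mathcal{B}(I)$ bounded. $\tilde{\mathcal{A}}:=\{x\in\mathbb{T}^d: f(x,\xi)=0\text{ for a.e. }\xi\in I\}$, $\mathcal{Z}:=\{(x,\xi)\in\tilde{\mathcal{A}}\times I: f(x,\xi)=0\}$. $\mathcal{U}^+(\mathbb{T}^d\times I)$: functions $u$ with $u(x,\cdot)$ Borel measurable and integrable on $I$ for each $x$ and $u(\cdot,\xi)$ upper semicontinuous for each $\xi$; $\mathcal{U}^-:=-\mathcal{U}^+$. Subsolution: whenever $\phi\in C^1(\mathbb{T}^d)$, $\xi\in I$, $u(\cdot,\xi)-\phi$ has a local maximum at $\hat x$, then $F(\hat x,D\phi(\hat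 x),\xi)+\int_I k(\xi,\eta)(u(\hat x,\xi)-u(\hat x,\eta))d\eta\le f(\hat x,\xi)$; supersolution: reverse inequality at local minima. Assumptions: (A1) $C_1|p|^m-C_2\le F(x,p,\xi)$ for constants $C_1,C_2>0$, $m>1$. (A2) $f\ge0$ and $\mathcal{A}:=\{x: f(x,\xi)=0\ \forall\xi\}\neq\emptyset$. (A3) $p\mapsto F(x,p,\xi)$ convex. (A4) $F\ge0$, $F(x,0,\xi)=0$. (A5) modulus $\omega$ with $|f(x,\xi)-f(y,\xi)|\le\omega(|x-y|)$; for each $R>0$ modulus $\omega_R$ with $|F(x,p,\xi)-F(y,q,\xi)|\le\omega_R(|x-y|+|p-q|)$ for $p,q\in B(0,R)$, uniformly in $\xi$. *)

(* Defs.v *)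
From HB Require Import structures.
From mathcomp Require Import all_boot all_order all_algebra.
From mathcomp Require Import all_classical all_reals all_analysis.
Set Implicit Arguments. Unset Strict Implicit. Unset Printing Implicit Defensive.
Import Order.TTheory GRing.Theory Num.Theory.
Import numFieldNormedType.Exports.
Local Open Scope classical_set_scope.
Local Open Scope ring_scope.

(* Points of R^d are row vectors 'rV[R]_d; functions on the torus T^d are
   represented by their Z^d-Zd_periodic lifts to R^d. *)

Definition unitvec {R : realType} {d : nat} (i : 'I_d) : 'rV[R]_d :=
  delta_mx 0 i.

Definition Zd_periodic {R : realType} {d : nat} {T : Type}
  (g : 'rV[R]_d -> T) : Prop :=
  forall (x : 'rV[R]_d) (i : 'I_d), g (x + unitvec i) = g x.

Definition enorm {R : realType} {d : nat} (v : 'rV[R]_d) : R :=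
  Num.sqrt (\sum_(i < d) v 0 i ^+ 2).

Definition usc {R : realType} {d : nat} (g : 'rV[R]_d -> R) : Prop :=
  forall x (e : R), 0 < e -> \forall y \near x, g y < g x + e.

Definition grad {R : realType} {d : nat} (phi : 'rV[R]_d -> R)
  (x : 'rV[R]_d) : 'rV[R]_d :=
  \row_(i < d) ('D_(unitvec i) phi x).

Definition C1_torus {R : realType} {d : nat} (phi : 'rV[R]_d -> R) : Prop :=
  Zd_periodic phi /\
  (forall x, differentiable phi x) /\
  (forall i : 'I_d, continuous (fun x => 'D_(unitvec i) phi x)).

Definition modulus {R : realType} (w : R -> R) : Prop :=
  (forall r, 0 <= r -> 0 <= w r) /\
  (forall r s, 0 <= r -> r <= s -> w r <= w s) /\
  (w r @[r --> 0^'+] --> 0).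

Definition Iset {R : realType} (a : R) (bl br : bool) : set R :=
  [set xi | xi \in Interval (BSide bl a) (BSide br (a + 1))].

Definition leb {R : realType} := (@lebesgue_measure R).

Definition nonlocal {R : realType} {d : nat} (I : set R) (k : R -> R -> R)
  (w : 'rV[R]_d -> R -> R) (x : 'rV[R]_d) (xi : R) : \bar R :=
  (\int[leb]_(eta in I) (k xi eta * (w x xi - w x eta))%:E)%E.

Definition Uplus {R : realType} {d : nat} (I : set R)
  (u : 'rV[R]_d -> R -> R) : Prop :=
  (forall x, measurable_fun I (u x) /\ leb.-integrable I (EFin \o u x)) /\
  (forall xi, I xi -> usc (fun x => u x xi) /\ Zd_periodic (fun x => u x xi)).

Definition Uminus {R : realType} {d : nat} (I : set R)
  (v : 'rV[R]_d -> R -> R) : Prop :=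
  Uplus I (fun x xi => - v x xi).

Definition subsolution {R : realType} {d : nat} (I : set R)
  (F : 'rV[R]_d -> 'rV[R]_d -> R -> R) (k : R -> R -> R)
  (f : 'rV[R]_d -> R -> R) (u : 'rV[R]_d -> R -> R) : Prop :=
  forall (phi : 'rV[R]_d -> R) (xi : R) (xh : 'rV[R]_d),
    C1_torus phi -> I xi ->
    (\forall y \near xh, u y xi - phi y <= u xh xi - phi xh) ->
    ((F xh (grad phi xh) xi)%:E + nonlocal I k u xh xi <= (f xh xi)%:E)%E.

Definition supersolution {R : realType} {d : nat} (I : set R)
  (F : 'rV[R]_d -> 'rV[R]_d -> R -> R) (k : R -> R -> R)
  (f : 'rV[R]_d -> R -> R) (v : 'rV[R]_d -> R -> R) : Prop :=
  forall (phi : 'rV[R]_d -> R) (xi : R) (xh : 'rV[R]_d),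
    C1_torus phi -> I xi ->
    (\forall y \near xh, v xh xi - phi xh <= v y xi - phi y) ->
    ((f xh xi)%:E <= (F xh (grad phi xh) xi)%:E + nonlocal I k v xh xi)%E.

Definition Atilde {R : realType} {d : nat} (I : set R)
  (f : 'rV[R]_d -> R -> R) : set 'rV[R]_d :=
  [set x | {ae leb, forall xi, I xi -> f x xi = 0}].

Definition Zset {R : realType} {d : nat} (I : set R)
  (f : 'rV[R]_d -> R -> R) : set ('rV[R]_d * R) :=
  [set xx | Atilde I f xx.1 /\ I xx.2 /\ f xx.1 xx.2 = 0].

(* Main.v *)
(** For [0 < l < 1] put [w := l u - v] and [M := sup w].  By convexity and
    [F(x,0) = 0], [l u] is a subsolution with right-hand side [l f], so doubling
    the variables at a maximum point [xh] of [w(., xi)] gives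
      [\int k(xi,eta) (w(xh,xi) - w(xh,eta)) d eta <= - (1 - l) f(xh,xi) <= 0].
    Coercivity bounds the gradients there, since [u] is bounded below at the
    contact points.  No regularity in [xi] is available, so [M] need not be
    attained a priori; but letting [w(xh,xi)] approach [M] the inequality forces
    [\int w(xh,.)] up to [M], and [x |-> \int w(x,.)] is upper semicontinuous by
    Fatou, hence [w(xb,.) = M] a.e. for some [xb].  Applying the inequality again
    at [xb] yields [f(xb,.) = 0] a.e., so that [u <= v] at some [(xb,eta)] with
    [w(xb,eta) = M], which bounds [M] by [(1 - l) C].  Let [l] tend to [1]. *)
Require Import Defs.
From HB Require Import structures.
From mathcomp Require Import all_boot all_order all_algebra.
From mathcomp Require Import all_classical all_reals all_analysis.
From mathcomp Require Import measurable_realfun ring lra.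
Import Order.TTheory GRing.Theory Num.Theory.
Import numFieldNormedType.Exports.
Local Open Scope classical_set_scope.
Local Open Scope ring_scope.
Set Implicit Arguments. Unset Strict Implicit. Unset Printing Implicit Defensive.

(** * Upper semicontinuous functions and their maxima on compact sets *)

(* On ['rV[R]_d] this is convertible to [usc]; the general domain is needed for
   functions on pairs of points. *)
Definition upper_semicont {R : realType} {T : topologicalType} (g : T -> R) :=
  forall x (e : R), 0 < e -> \forall y \near x, g y < g x + e.

Lemma upper_semicontD (R : realType) (T : topologicalType) (g h : T -> R) :
  upper_semicont g -> upper_semicont h -> upper_semicont (fun x => g x + h x).
Proof.
move=> ug uh x e e0; have e2 : 0 < e / 2 by lra.
near=> y.
have gy : g y < g x + e / 2 by near: y; exact: ug.
have hy : h y < h x + e / 2 by near: y; exact: uh.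
by lra.
Unshelve. all: by end_near. Qed.

Lemma upper_semicontZ (R : realType) (T : topologicalType) (c : R) (g : T -> R) :
  0 < c -> upper_semicont g -> upper_semicont (fun x => c * g x).
Proof.
move=> c0 ug x e e0; have ec : 0 < e / c by exact: divr_gt0.
near=> y.
have : g y < g x + e / c by near: y; exact: ug.
by rewrite -(ltr_pM2l c0) mulrDr (mulrC e) mulVKf// gt_eqF.
Unshelve. all: by end_near. Qed.

Lemma continuous_upper_semicont (R : realType) (T : topologicalType)
  (g : T -> R) : continuous g -> upper_semicont g.
Proof.
move=> cg x e e0.
have /cvgrPdist_lt/(_ e e0) := cg x.
apply: filterS => y; rewrite ltr_distlC => /andP[]; lra.
Qed.

Lemma upper_semicont_comp (R : realType) (S T : topologicalType)
  (g : T -> R) (h : S -> T) :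
  continuous h -> upper_semicont g -> upper_semicont (g \o h).
Proof. by move=> ch ug x e e0; have := ch x _ (ug (h x) e e0); exact. Qed.

(** If the supremum [s] were not attained, upper semicontinuity would give each point of [K] a
    neighbourhood where [g < s - 1/(n+1)] for all large [n]. By compactness one [n] works on all of
    [K], against the definition of [s]. *)
Lemma compact_upper_semicont_max (R : realType) (T : topologicalType)
  (K : set T) (g : T -> R) (C : R) :
  compact K -> K !=set0 -> upper_semicont g -> (forall x, K x -> g x <= C) ->
  exists2 x, K x & forall y, K y -> g y <= g x.
Proof.
move=> cK [x0 Kx0] ug gC; set s := sup (g @` K).
have hs : has_sup (g @` K).
  by split; [exists (g x0), x0 | exists C => _ [x Kx <-]; exact: gC].
have gs x : K x -> g x <= s by move=> Kx; apply: (ub_le_sup hs.2); exists x.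
apply: contrapT => nomax.
have lts x : K x -> g x < s.
  move=> Kx; rewrite lt_neqAle gs// andbT; apply/eqP => gxs.
  by apply: nomax; exists x => // y Ky; rewrite gxs gs.
have /compact_near_coveringP cov := cK.
have : \forall n \near \oo, K `<=` (fun x => g x < s - n.+1%:R^-1).
  apply: cov => x Kx.
  have e0 : 0 < (s - g x) / 2 by have := lts x Kx; lra.
  near=> y n => /=.
  have gy : g y < g x + (s - g x) / 2 by near: y; exact: ug.
  have : n.+1%:R^-1 < (s - g x) / 2 by near: n; exact: (near_infty_natSinv_lt (PosNum e0)).
  by move: n.+1%:R^-1 => r; lra.
move=> [n _ /(_ n (leqnn n)) /= Kn].
have n0 : (0 : R) < n.+1%:R^-1 by rewrite invr_gt0.
have : s <= s - n.+1%:R^-1.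
  apply: ge_sup; first by exists (g x0), x0.
  by move=> _ [x Kx <-]; exact/ltW/Kn.
by move: n.+1%:R^-1 n0 => r; lra.
Unshelve. all: by end_near. Qed.

(** * Fatou's lemma and semicontinuity of integrals depending on a parameter *)

Lemma limn_einf_ge_near (R : realType) (a : \bar R) (w : (\bar R)^nat) :
  (\forall n \near \oo, (a <= w n)%E) -> (a <= limn_einf w)%E.
Proof.
move=> [N _ aw]; rewrite limn_einf_lim; apply: lime_ge.
  exact: is_cvg_einfs.
exists N => // n Nn; apply: le_ereal_inf_tmp => _ [m /= nm <-].
by apply: aw => /=; exact: leq_trans nm.
Qed.

Lemma limn_einf_le (R : realType) (b : \bar R) (w : (\bar R)^nat) :
  (forall n, (w n <= b)%E) -> (limn_einf w <= b)%E.
Proof.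
move=> wb; rewrite limn_einf_lim; apply: lime_le.
  exact: is_cvg_einfs.
apply: nearW => n; apply: le_trans (wb n).
by apply: ereal_inf_lbound; exists n => /=.
Qed.

Lemma bounded_on_le (R : realType) (S : Type) (D : set S) (g : S -> R) (b : R) :
  (forall t, D t -> `|g t| <= b) -> [bounded g t | t in D].
Proof.
move=> gb; exists b; split; first exact: num_real.
by move=> M bM t Dt; apply: le_trans (gb _ Dt) (ltW bM).
Qed.

Lemma integrable_bounded (d : measure_display) (S : measurableType d)
  (R : realType) (mu : {measure set S -> \bar R}) (D : set S) (g : S -> R) (b : R) :
  measurable D -> (mu D < +oo)%E -> measurable_fun D g ->
  (forall t, D t -> `|g t| <= b) -> mu.-integrable D (EFin \o g).
Proof.
move=> mD Dfin mg gb; apply: measurable_bounded_integrable => //.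
exact: bounded_on_le gb.
Qed.

Lemma integrable_boundedM (d : measure_display) (S : measurableType d)
  (R : realType) (mu : {measure set S -> \bar R}) (D : set S) (g h : S -> R)
  (b : R) :
  measurable D -> measurable_fun D g -> (forall t, D t -> `|g t| <= b) ->
  mu.-integrable D (EFin \o h) ->
  mu.-integrable D (EFin \o (fun t => g t * h t)).
Proof.
move=> mD mg gb ih.
have bg := bounded_on_le gb.
by have := integrableMr mD mg bg ih; apply: eq_integrable.
Qed.

(** Reverse Fatou: a failure at [x] yields points [z n] tending to [x] whose integrals exceed the
    one at [x] by at least [e], which contradicts Fatou's lemma for the nonnegative functions
    [C - h (z n)]. *)
Lemma upper_semicont_Rintegral (d : measure_display) (S : measurableType d)
  (R : realType) (mu : {measure set S -> \bar R}) (T : pseudoMetricType R)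
  (D : set S) (h : T -> S -> R) (C : R) :
  measurable D -> (mu D < +oo)%E ->
  (forall x, mu.-integrable D (EFin \o h x)) ->
  (forall x t, D t -> h x t <= C) ->
  (forall t, D t -> upper_semicont (fun x => h x t)) ->
  upper_semicont (fun x => \int[mu]_(t in D) h x t).
Proof.
move=> mD Dfin ih hC uh x e e0; apply: contrapT => far.
have icst : mu.-integrable D (EFin \o cst C).
  by apply: (@integrable_bounded _ _ _ _ _ _ `|C|).
have /choice[z zP] : forall n : nat, exists y, ball x n.+1%:R^-1 y /\
    \int[mu]_(t in D) h x t + e <= \int[mu]_(t in D) h y t.
  move=> n; apply: contrapT => nz; apply: far.
  apply/nbhs_ballP; exists n.+1%:R^-1 => /=; first by rewrite invr_gt0.
  by move=> y xy; rewrite ltNge; apply/negP => hy; apply: nz; exists y.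
have zx : z n @[n --> \oo] --> x.
  apply/cvg_ballP => r r0; near=> n.
  apply: (@le_ball _ _ _ n.+1%:R^-1); last exact: (zP n).1.
  by apply: ltW; near: n; exact: (near_infty_natSinv_lt (PosNum r0)).
have iB y : mu.-integrable D (EFin \o (fun t => C - h y t)).
  by have := integrableB mD icst (ih y).
have RB y : \int[mu]_(t in D) (C - h y t) =
    \int[mu]_(t in D) C - \int[mu]_(t in D) h y t by exact: RintegralB.
have EB y : (\int[mu]_(t in D) (C - h y t)%:E)%E =
   (\int[mu]_(t in D) C - \int[mu]_(t in D) h y t)%:E.
  by rewrite -RB /Rintegral fineK//; exact: integrable_fin_num (iB y).
have : (\int[mu]_(t in D) (C - h x t)%:E <=
        (\int[mu]_(t in D) C - (\int[mu]_(t in D) h x t + e))%:E)%E.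
  apply: (@le_trans _ _ (\int[mu]_(t in D)
           limn_einf (fun n => (C - h (z n) t)%:E))%E).
    apply: ge0_le_integral => //=.
    - by move=> t Dt; rewrite lee_fin subr_ge0 hC.
    - exact: measurable_int (iB x).
    (* A lower limit is the opposite of the upper limit of the opposites, so its measurability
       reduces to that of upper limits. *)
    - have mN (g : S -> \bar R) : measurable_fun D g ->
          measurable_fun D (fun t => - g t)%E.
        by move=> mg; exact: measurableT_comp (@oppe_measurable R setT) mg.
      apply: (mN); apply: measurable_fun_limn_esup => n.
      by apply: mN; exact: measurable_int (iB (z n)).
    - move=> t Dt; apply/lee_addgt0Pr => r r0.
      rewrite -leeBlDr// -EFinB; apply: limn_einf_ge_near.
      have : \forall n \near \oo, h (z n) t < h x t + r.
        by have := zx _ (uh t Dt x r r0); exact.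
      by apply: filterS => n hn; rewrite lee_fin; lra.
  apply: le_trans.
    apply: fatou => //= [n|n t Dt].
      exact: measurable_int (iB (z n)).
    by rewrite lee_fin subr_ge0 hC.
  apply: limn_einf_le => n; rewrite EB lee_fin.
  by have := (zP n).2; lra.
rewrite EB lee_fin; lra.
Unshelve. all: by end_near. Qed.

(** * Test functions that are sums of one-variable functions *)

Lemma continuous_sumr (R : realType) (T : topologicalType) (n : nat)
  (h : 'I_n -> T -> R) :
  (forall i, continuous (h i)) -> continuous (fun x => \sum_(i < n) h i x).
Proof.
move=> ch; apply: continuous_big; first exact: add_continuous.
by move=> i _; exact: ch.
Qed.

Section separable.
Variables (R : realType) (d : nat) (g g' : 'I_d -> R -> R).
Hypothesis g_derive : forall i (r : R), is_derive r 1 (g i) (g' i r).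

Let phi (x : 'rV[R]_d) := \sum_(i < d) g i (x 0 i).

Let diff_term (i : 'I_d) (x : 'rV[R]_d) :
  differentiable (fun x : 'rV[R]_d => g i (x 0 i)) x.
Proof.
apply: (@differentiable_comp _ _ _ _ (fun x : 'rV[R]_d => x 0 i) (g i)).
  exact: differentiable_coord.
by apply/derivable1_diffP; have [] := g_derive i (x 0 i).
Qed.

Let derive_term (i j : 'I_d) (x : 'rV[R]_d) :
  is_derive x (unitvec j) (fun x : 'rV[R]_d => g i (x 0 i))
    ((i == j)%:R * g' i (x 0 i)).
Proof.
apply: DeriveDef; first exact: diff_derivable.
have [gd gE] := g_derive i (x 0 i).
have gd1 : differentiable (g i) (x 0 i) by apply/derivable1_diffP.
have cd := @differentiable_coord R 1 d x 0 i.
(* A coordinate is linear and continuous, hence equal to its own differential. *)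
have cE : 'd (fun x : 'rV[R]_d => x 0 i) x (unitvec j) = (i == j)%:R :> R.
  pose c (x : 'rV[R]_d) := x 0 i.
  have lc : linear c by move=> a y z; rewrite /c !mxE.
  pose cL : {linear 'rV[R]_d -> R} := HB.pack c (GRing.isLinear.Build _ _ _ _ c lc).
  have -> : 'd (fun x : 'rV[R]_d => x 0 i) x = cL :> (_ -> _).
    by apply: (@diff_lin _ _ _ cL x); exact: coord_continuous.
  by rewrite /= /c /unitvec mxE eqxx.
rewrite deriveE; last exact: diff_term.
rewrite (_ : (fun x : 'rV[R]_d => g i (x 0 i)) =
  g i \o (fun x : 'rV[R]_d => x 0 i))// diff_comp//=.
rewrite cE -gE deriveE//.
by rewrite -[in LHS](mulr1 (i == j)%:R) -[_ * 1]/(_ *: 1) linearZ.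
Qed.

Lemma separable_differentiable x : differentiable phi x.
Proof.
rewrite (_ : phi = \sum_(i < d) (fun x : 'rV[R]_d => g i (x 0 i))).
  by apply: differentiable_sum => i; exact: diff_term.
by apply/funext => y; rewrite fct_sumE.
Qed.

Lemma separable_derive j x : 'D_(unitvec j) phi x = g' j (x 0 j).
Proof.
have [] := is_derive_sum (fun i => derive_term i j x).
rewrite (_ : \sum_(i < d) _ = phi); last first.
  by apply/funext => y; rewrite fct_sumE.
move=> _ ->; rewrite (bigD1 j)//= eqxx mul1r big1 ?addr0// => i /negPf ->.
by rewrite mul0r.
Qed.

Lemma separable_grad x : grad phi x = \row_j g' j (x 0 j).
Proof. by apply/rowP => j; rewrite !mxE separable_derive. Qed.

Lemma separable_C1_torus :
  (forall i r, g i (r + 1) = g i r) -> (forall i, continuous (g' i)) ->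
  C1_torus phi.
Proof.
move=> gp cg'; split; [|split].
- move=> x i; apply: eq_bigr => j _; rewrite !mxE eqxx/=.
  by case: (j == i); rewrite ?gp ?addr0.
- exact: separable_differentiable.
- move=> i; rewrite (_ : (fun x => _) = (fun x : 'rV[R]_d => g' i (x 0 i))).
    by move=> x; apply: continuous_comp; [exact: coord_continuous|exact: cg'].
  by apply/funext => x; exact: separable_derive.
Qed.

End separable.

(** * A smooth 1-periodic substitute for the square, and the torus penalty built from it *)

Definition sin2 {R : realType} (r : R) : R := sin (pi * r) ^+ 2.

Definition dsin2 {R : realType} (r : R) : R :=
  2 * pi * (sin (pi * r) * cos (pi * r)).

Lemma is_derive_sin2 (R : realType) (c r : R) :
  is_derive r 1 (fun r : R => sin2 (r - c)) (dsin2 (r - c)).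
Proof.
have sd : is_derive r 1 (fun r : R => sin (pi * (r - c))) (cos (pi * (r - c)) * pi).
  apply: (@is_derive1_comp R sin (fun r : R => pi * (r - c)) r).
  have : is_derive r 1 (fun r : R => pi *: (r - c)) (pi *: (1 - 0 : R)).
    by apply: is_deriveZ.
  by rewrite subr0 -[pi *: 1]/(pi * 1) mulr1.
apply: (is_derive_eq (is_deriveM sd sd)).
by rewrite /dsin2 /GRing.scale/=; ring.
Qed.

Lemma sin2_periodic (R : realType) (r : R) : sin2 (r + 1) = sin2 r.
Proof. by rewrite /sin2 mulrDr mulr1 sinDpi sqrrN. Qed.

Lemma dsin2N (R : realType) (r : R) : dsin2 (- r) = - dsin2 r.
Proof. by rewrite /dsin2 mulrN sinN cosN mulNr mulrN. Qed.

Lemma dsin20 (R : realType) : dsin2 (0 : R) = 0.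
Proof. by rewrite /dsin2 mulr0 sin0 mul0r mulr0. Qed.

Lemma sin2N (R : realType) (r : R) : sin2 (- r) = sin2 r.
Proof. by rewrite /sin2 mulrN sinN sqrrN. Qed.

Lemma continuous_dsin2 (R : realType) : continuous (@dsin2 R).
Proof.
move=> r; apply: cvgM; first exact: cvg_cst.
have cpi : (pi * x : R) @[x --> r] --> pi * r by apply: cvgM => //; exact: cvg_cst.
by apply: cvgM; [apply: (cvg_comp _ _ cpi); exact: continuous_sin|
                 apply: (cvg_comp _ _ cpi); exact: continuous_cos].
Qed.

Lemma continuous_sin2 (R : realType) : continuous (@sin2 R).
Proof.
move=> r; have cpi : (pi * x : R) @[x --> r] --> pi * r.
  by apply: cvgM => //; exact: cvg_cst.
have cs : sin (pi * x : R) @[x --> r] --> sin (pi * r).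
  by apply: (cvg_comp _ _ cpi); exact: continuous_sin.
exact: (cvgM cs cs).
Qed.

(** [sin (pi * r)] vanishes at every integer; the bound [2^-1] isolates the root [0]. *)
Lemma sin2_eq0 (R : realType) (r : R) : `|r| <= 2^-1 -> sin2 r = 0 -> r = 0.
Proof.
wlog r0 : r / 0 < r => [hw|].
  have [r0|r0|->//] := ltgtP r 0; last exact: hw.
  rewrite -normrN -sin2N => r2 rE; apply: oppr_inj; rewrite oppr0.
  by apply: hw => //; rewrite oppr_gt0.
rewrite gtr0_norm// => r2 /eqP; rewrite sqrf_eq0 => /eqP sE.
have p0 := pi_gt0 R.
have : 0 < sin (pi * r).
  by apply: sin_gt0_pi; rewrite mulr_gt0//= -[ltRHS]mulr1 ltr_pM2l//; lra.
by rewrite sE ltxx.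
Qed.

(* The periodic counterpart of the squared distance. *)
Definition psi {R : realType} {d : nat} (z : 'rV[R]_d) : R :=
  \sum_(i < d) sin2 (z 0 i).

Definition dpsi {R : realType} {d : nat} (z : 'rV[R]_d) : 'rV[R]_d :=
  \row_i dsin2 (z 0 i).

Lemma psi0 (R : realType) (d : nat) : psi (0 : 'rV[R]_d) = 0.
Proof.
by rewrite /psi big1// => i _; rewrite mxE /sin2 mulr0 sin0 expr0n.
Qed.

Lemma psi_ge0 (R : realType) (d : nat) (z : 'rV[R]_d) : 0 <= psi z.
Proof. by apply: sumr_ge0 => i _; exact: sqr_ge0. Qed.

Lemma psiN (R : realType) (d : nat) (z : 'rV[R]_d) : psi (- z) = psi z.
Proof. by apply: eq_bigr => i _; rewrite mxE sin2N. Qed.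

Lemma dpsiN (R : realType) (d : nat) (z : 'rV[R]_d) : dpsi (- z) = - dpsi z.
Proof. by apply/rowP => i; rewrite !mxE dsin2N. Qed.

Lemma dpsi0 (R : realType) (d : nat) : dpsi (0 : 'rV[R]_d) = 0.
Proof. by apply/rowP => i; rewrite !mxE dsin20. Qed.

Lemma continuous_psi (R : realType) (d : nat) : continuous (@psi R d).
Proof.
apply: continuous_sumr => i z.
by apply: (@continuous_comp _ _ _ (fun z : 'rV[R]_d => z 0 i));
  [exact: coord_continuous|exact: continuous_sin2].
Qed.

Lemma psi_eq0 (R : realType) (d : nat) (z : 'rV[R]_d) :
  (forall i, `|z 0 i| <= 2^-1) -> psi z = 0 -> z = 0.
Proof.
move=> z2 /eqP; rewrite psumr_eq0 => [/allP zE|i _]; last exact: sqr_ge0.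
apply/rowP => i; rewrite mxE; apply: sin2_eq0 => //.
by apply/eqP/zE; rewrite mem_index_enum.
Qed.

(** Two centres at once: the test function for [u] carries a doubling term and a localizing term,
    while the one for [v] takes [t = 0]. *)
Lemma C1_torus_psi (R : realType) (d : nat) (s t : R) (y w : 'rV[R]_d) :
  let phi x := s * psi (x - y) + t * psi (x - w) in
  C1_torus phi /\ forall x, grad phi x = s *: dpsi (x - y) + t *: dpsi (x - w).
Proof.
pose g i r := s * sin2 (r - y 0 i) + t * sin2 (r - w 0 i).
pose g' i r := s * dsin2 (r - y 0 i) + t * dsin2 (r - w 0 i).
have gd i (r : R) : is_derive r 1 (g i) (g' i r).
  by apply: is_deriveD; apply: is_deriveZ; exact: is_derive_sin2.
move=> phi; have -> : phi = fun x => \sum_(i < d) g i (x 0 i).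
  apply/funext => x; rewrite /phi /psi !mulr_sumr -big_split/=.
  by apply: eq_bigr => i _; rewrite !mxE.
split; last first.
  by move=> x; rewrite (separable_grad gd); apply/rowP => i; rewrite !mxE.
apply: (separable_C1_torus gd).
  by move=> i r; rewrite /g !(addrAC r 1) !sin2_periodic.
move=> i r; have c c0 : dsin2 (z - c0 : R) @[z --> r] --> dsin2 (r - c0).
  apply: (@cvg_comp _ _ _ (fun z => z - c0)); last exact: continuous_dsin2.
  by apply: cvgB => //; exact: cvg_cst.
by apply: cvgD; apply: cvgM; [exact: cvg_cst|exact: c|exact: cvg_cst|exact: c].
Qed.

(** * The Euclidean norm *)

Lemma enorm0 (R : realType) (d : nat) : enorm (0 : 'rV[R]_d) = 0.
Proof.
by rewrite /enorm big1 ?sqrtr0// => i _; rewrite mxE expr0n.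
Qed.

Lemma continuous_enorm (R : realType) (d : nat) : continuous (@enorm R d).
Proof.
move=> z; apply: (@continuous_comp _ _ _ (fun z : 'rV[R]_d => _) Num.sqrt).
  apply: continuous_sumr => i x.
  have cx : (y 0 i : R) @[y --> x] --> x 0 i by exact: coord_continuous.
  exact: (cvgM cx cx).
exact: sqrt_continuous.
Qed.

Lemma continuous_enorm_dpsi (R : realType) (d : nat) :
  continuous (fun z : 'rV[R]_d => enorm (dpsi z)).
Proof.
move=> z; apply: (@continuous_comp _ _ _ (fun z : 'rV[R]_d => _) Num.sqrt).
  apply: continuous_sumr => i x.
  have cx : dsin2 (y 0 i : R) @[y --> x] --> dsin2 (x 0 i).
    have cc : (y 0 i : R) @[y --> x] --> x 0 i by exact: coord_continuous.
    exact: (cvg_comp _ _ cc (@continuous_dsin2 R (x 0 i))).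
  rewrite (_ : (fun x : 'rV[R]_d => _) = fun x => dsin2 (x 0 i) * dsin2 (x 0 i)).
    by rewrite /continuous_at; exact: (cvgM cx cx).
  by apply/funext => y; rewrite mxE expr2.
exact: sqrt_continuous.
Qed.

(* Young's inequality gives this quasi-triangle inequality without
   Cauchy-Schwarz; the constant is irrelevant. *)
Lemma ler_enormD2 (R : realType) (d : nat) (p q : 'rV[R]_d) :
  enorm (p + q) <= 2 * (enorm p + enorm q).
Proof.
have ge0 (r : 'rV[R]_d) : 0 <= enorm r by exact: sqrtr_ge0.
have sq (r : 'rV[R]_d) : enorm r ^+ 2 = \sum_(i < d) r 0 i ^+ 2.
  by rewrite sqr_sqrtr//; apply: sumr_ge0 => i _; exact: sqr_ge0.
have : enorm (p + q) ^+ 2 <= 2 * (enorm p ^+ 2 + enorm q ^+ 2).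
  rewrite !sq -big_split mulr_sumr; apply: ler_sum => i _ /=; rewrite mxE.
  by have := sqr_ge0 (p 0 i - q 0 i); lra.
have := ge0 p; have := ge0 q; have := ge0 (p + q); nra.
Qed.

Lemma norm_coord_le (R : realType) (d : nat) (z : 'rV[R]_d) (i : 'I_d) :
  `|z 0 i| <= `|z|.
Proof.
rewrite [leRHS]/Num.norm/= mx_normrE.
exact: (le_bigmax _ (fun ij : 'I_1 * 'I_d => `|z ij.1 ij.2|) (0, i)).
Qed.

(** * Periodicity and the compact fundamental cell *)

Lemma Zd_periodic_int (R : realType) (d : nat) (T : Type) (g : 'rV[R]_d -> T)
  (i : 'I_d) (n : int) (x : 'rV[R]_d) :
  Zd_periodic g -> g (x + n%:~R *: unitvec i) = g x.
Proof.
move=> gp.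
have gn (m : nat) y : g (y + m%:R *: unitvec i) = g y.
  elim: m => [|m IH]; first by rewrite scale0r addr0.
  by rewrite -natr1 scalerDl scale1r addrA gp.
case: n => m; first exact: gn.
by rewrite NegzE mulrNz scaleNr -(gn m.+1) subrK.
Qed.

Definition unit_cell {R : realType} {d : nat} : set 'rV[R]_d :=
  [set z | forall i, z 0 i \in `[0, 1]].

Lemma compact_unit_cell (R : realType) (d : nat) : compact (@unit_cell R d).
Proof.
have := @rV_compact R d (fun=> `[0, 1]%classic) (fun=> @segment_compact R 0 1).
by [].
Qed.

Lemma unit_cell_neq0 (R : realType) (d : nat) : @unit_cell R d !=set0.
Proof. by exists 0 => i; rewrite mxE in_itv/= lexx ler01. Qed.

(** Subtracting the integer parts of the coordinates is a lattice translation, undone one coordinate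
    at a time. *)
Lemma unit_cell_representative (R : realType) (d : nat) (x : 'rV[R]_d) :
  exists2 z, unit_cell z &
    forall (T : Type) (g : 'rV[R]_d -> T), Zd_periodic g -> g x = g z.
Proof.
pose z : 'rV[R]_d := \row_i (x 0 i - (Num.floor (x 0 i))%:~R).
exists z => [i|T g gp].
  rewrite mxE in_itv/=; have := floor_itv (x 0 i).
  by rewrite intrD => /andP[]; lra.
have gs (r : seq 'I_d) y :
    g (y + \sum_(i <- r) (Num.floor (x 0 i))%:~R *: unitvec i) = g y.
  elim: r y => [|i r IH] y; first by rewrite big_nil addr0.
  by rewrite big_cons addrA IH Zd_periodic_int.
rewrite -(gs (index_enum _) z); congr g; apply/rowP => j.
rewrite !mxE summxE (bigD1 j)//= big1 => [|i ij].
  by rewrite addr0 mxE /unitvec mxE !eqxx mulr1 subrK.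
by rewrite mxE /unitvec mxE eqxx eq_sym (negPf ij) mulr0.
Qed.

(** * Doubling of variables on the torus *)

(* Doubling of variables; the term [psi (x - xh)] makes [xh] a strict maximum
   so that the maximum points of the penalized function converge to it. *)
Lemma doubling (R : realType) (d : nat) (U V : 'rV[R]_d -> R) (C : R)
  (xh : 'rV[R]_d) (P : set ('rV[R]_d * 'rV[R]_d)) :
  upper_semicont U -> upper_semicont (fun y => - V y) ->
  (forall x, U x <= C) -> (forall x, - V x <= C) ->
  (forall x, U x - V x <= U xh - V xh) -> nbhs (xh, xh) P ->
  exists (n : nat) (x y : 'rV[R]_d),
    [/\ P (x, y), U xh - V xh <= U x - V y,
     \forall x' \near x, U x' - n%:R * psi (x' - y) - psi (x' - xh) <=
                         U x - n%:R * psi (x - y) - psi (x - xh) &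
     \forall y' \near y, V y + n%:R * psi (x - y) <=
                         V y' + n%:R * psi (x - y')].
Proof.
move=> uU uV UC VC xhmax nP.
set m := U xh - V xh.
(* The half-width [4^-1] keeps coordinates of differences within [2^-1], where [psi] vanishes only
   at [0]. *)
pose A : set 'rV[R]_d := [set v | forall i, v 0 i \in `[xh 0 i - 4^-1, xh 0 i + 4^-1]].
have cA : compact A.
  exact: (@rV_compact R d (fun i => [set` `[xh 0 i - 4^-1, xh 0 i + 4^-1]])
    (fun i => @segment_compact R _ _)).
have A_near x : `|x - xh| < 4^-1 -> A x.
  move=> xxh i; have := le_lt_trans (norm_coord_le (x - xh) i) xxh.
  by rewrite !mxE in_itv/= ltr_norml => /andP[]; lra.
have Axh : A xh by apply: A_near; rewrite subrr normr0; lra.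
have A2 x y : A x -> A y -> forall i, `|(x - y) 0 i| <= 2^-1.
  move=> Ax Ay i; have := Ax i; have := Ay i; rewrite !mxE !in_itv/=.
  by move=> /andP[? ?] /andP[? ?]; rewrite ler_norml; apply/andP; split; lra.
have cp : continuous (fun z : 'rV[R]_d * 'rV[R]_d => psi (z.1 - z.2)).
  move=> z; apply: (@continuous_comp _ _ _ (fun z : 'rV[R]_d * 'rV[R]_d => z.1 - z.2)).
    by apply: cvgB; [exact: cvg_fst|exact: cvg_snd].
  exact: continuous_psi.
have cq : continuous (fun z : 'rV[R]_d * 'rV[R]_d => psi (z.1 - xh)).
  move=> z; apply: (@continuous_comp _ _ _ (fun z : 'rV[R]_d * 'rV[R]_d => z.1 - xh)).
    by apply: cvgB; [exact: cvg_fst|exact: cvg_cst].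
  exact: continuous_psi.
pose W (z : 'rV[R]_d * 'rV[R]_d) := U z.1 + - V z.2.
have uW : upper_semicont W.
  apply: upper_semicontD; [apply: (upper_semicont_comp (h := fst)) uU|
                           apply: (upper_semicont_comp (h := snd)) uV].
    by move=> z; exact: cvg_fst.
  by move=> z; exact: cvg_snd.
pose Phi (n : nat) z := W z + (- (n%:R * psi (z.1 - z.2) + psi (z.1 - xh))).
have uPhi n : upper_semicont (Phi n).
  apply: upper_semicontD uW _; apply: continuous_upper_semicont => z.
  by apply: cvgN; apply: cvgD (cq z); apply: cvgM (cp z); exact: cvg_cst.
have Phixh n : Phi n (xh, xh) = m.
  by rewrite /Phi /W /= subrr psi0 mulr0 addr0 oppr0 addr0.
pose Q : set ('rV[R]_d * 'rV[R]_d) :=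
  [set z | [/\ P z, `|z.1 - xh| < 4^-1 & `|z.2 - xh| < 4^-1]].
have nQ : nbhs (xh, xh) Q.
  have n4 : \forall x \near xh, `|x - xh| < 4^-1.
    apply/nbhs_normP; exists 4^-1; first by rewrite /=; lra.
    by move=> y /=; rewrite distrC.
  near=> z; split; first by near: z.
    by near: z; exact: (cvg_fst n4).
  by near: z; exact: (cvg_snd n4).
have cAA : compact (A `*` A) by exact: compact_setX.
(* Compactness gives one [n] for the whole box. Off the diagonal the term [n%:R * psi] pushes [Phi]
   below [m]; on the diagonal away from [xh], [W <= m] and the localizing term does so; near
   [(xh, xh)] the set [Q] takes over. *)
have : \forall n \near \oo, A `*` A `<=` (fun z => Phi n z < m \/ Q z).
  have /compact_near_coveringP cov := cAA.
  apply: cov => -[x0 y0] [/= Ax0 Ay0].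
  have [xy0|xy0] := eqVneq x0 y0; last first.
    have c0 : 0 < psi (x0 - y0).
      rewrite lt_neqAle psi_ge0 andbT eq_sym; apply/negP => /eqP p0.
      by move/negP: xy0; apply; rewrite -subr_eq0 (psi_eq0 (A2 _ _ Ax0 Ay0) p0).
    set c := psi (x0 - y0) in c0.
    near=> z n; left.
    have pz : c / 2 < psi (z.1 - z.2).
      near: z; have /cvgrPdist_lt/(_ (c / 2)) := cp (x0, y0).
      move=> /(_ ltac:(lra)); apply: filterS => z /=.
      by rewrite ltr_norml -/c => /andP[]; lra.
    (* [W <= 2 * C], so a penalty above [2 * C - m + 1] forces [Phi < m]. *)
    have nz : (2 * C - m + 1) / (c / 2) < n%:R.
      by near: n; exact: nbhs_infty_gtr.
    rewrite ltr_pdivrMr in nz; last by lra.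
    have n0 : 0 <= n%:R :> R by [].
    have np : n%:R * (c / 2) <= n%:R * psi (z.1 - z.2).
      by apply: ler_wpM2l => //; exact: ltW.
    have := UC z.1; have := VC z.2; have := psi_ge0 (z.1 - xh).
    by rewrite /Phi /W; lra.
  subst y0; have [->|x0h] := eqVneq x0 xh.
    near=> z n; right; near: z; exact: nQ.
  have c0 : 0 < psi (x0 - xh).
    rewrite lt_neqAle psi_ge0 andbT eq_sym; apply/negP => /eqP p0.
    by move/negP: x0h; apply; rewrite -subr_eq0 (psi_eq0 (A2 _ _ Ax0 Axh) p0).
  set c := psi (x0 - xh) in c0.
  near=> z n; left.
  have pz : c / 2 < psi (z.1 - xh).
    near: z; have /cvgrPdist_lt/(_ (c / 2)) := cq (x0, x0).
    move=> /(_ ltac:(lra)); apply: filterS => z /=.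
    by rewrite ltr_norml -/c => /andP[]; lra.
  have wz : W z < W (x0, x0) + c / 2 by near: z; apply: uW; lra.
  have : 0 <= n%:R * psi (z.1 - z.2) by rewrite mulr_ge0// psi_ge0.
  have : W (x0, x0) <= m by exact: xhmax.
  by rewrite /Phi; lra.
move=> [n _ /(_ n (leqnn n)) small].
have PhiC z : Phi n z <= 2 * C.
  have : 0 <= n%:R * psi (z.1 - z.2) by rewrite mulr_ge0// psi_ge0.
  by have := UC z.1; have := VC z.2; have := psi_ge0 (z.1 - xh); rewrite /Phi /W; lra.
have AA0 : (A `*` A) !=set0 by exists (xh, xh).
have [[x y] AAxy xymax] :=
  compact_upper_semicont_max cAA AA0 (uPhi n) (fun z _ => PhiC z).
have := xymax (xh, xh) (conj Axh Axh); rewrite Phixh => mxy.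
(* The maximum is at least [Phi n (xh, xh) = m], which leaves only [Q]. Then [x] and [y] are
   interior to [A], and the maximum over the box is a local one. *)
have [|[Pxy /= xA yA]] := small _ AAxy; first by rewrite ltNge mxy.
have near_A (w : 'rV[R]_d) : `|w - xh| < 4^-1 -> \forall w' \near w, A w'.
  move=> wA; apply/nbhs_normP; exists (4^-1 - `|w - xh|); first by rewrite /= subr_gt0.
  move=> w' /= ww'; apply: A_near.
  by have := ler_distD w w' xh; rewrite distrC in ww'; lra.
exists n, x, y; split=> //.
- have := psi_ge0 (x - xh); have : 0 <= n%:R * psi (x - y).
    by rewrite mulr_ge0// psi_ge0.
  by move: mxy; rewrite /Phi /W/=; lra.
- near=> x'; have Ax' : A x' by near: x'; exact: near_A.
  by have := xymax (x', y) (conj Ax' AAxy.2); rewrite /Phi /W/=; lra.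
- near=> y'; have Ay' : A y' by near: y'; exact: near_A.
  by have := xymax (x, y') (conj AAxy.1 Ay'); rewrite /Phi /W/=; lra.
Unshelve. all: by end_near. Qed.

Lemma enormN (R : realType) (d : nat) (p : 'rV[R]_d) : enorm (- p) = enorm p.
Proof.
by rewrite /enorm; congr Num.sqrt; apply: eq_bigr => i _; rewrite mxE sqrrN.
Qed.

(** * The inequality at a maximum of [gap] for fixed [xi] *)

Section comparison.
Variables (R : realType) (d : nat) (I : set R).
Variables (k : R -> R -> R) (k0 k1 : R).
Variables (F : 'rV[R]_d -> 'rV[R]_d -> R -> R) (f u v : 'rV[R]_d -> R -> R).
Variables (C l : R).

Let T := measurableTypeR R.

Hypothesis mI : measurable (I : set T).
Hypothesis leb_I : leb I = 1%E.
Hypothesis mk : measurable_fun (I `*` I) (fun p : R * R => k p.1 p.2).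
Hypothesis k0_gt0 : 0 < k0.
Hypothesis k_bound : forall xi eta, I xi -> I eta -> k0 <= k xi eta /\ k xi eta <= k1.
Hypothesis F_coercive : exists C1 C2 m : R, 0 < C1 /\ 0 < C2 /\ 1 < m /\
  forall x p xi, I xi -> C1 * (enorm p `^ m) - C2 <= F x p xi.
Hypothesis F_convex : forall x xi p q (t : R), I xi -> 0 <= t -> t <= 1 ->
  F x (t *: p + (1 - t) *: q) xi <= t * F x p xi + (1 - t) * F x q xi.
Hypothesis F0 : forall x xi, I xi -> F x 0 xi = 0.
Hypothesis F_modulus : forall Rr : R, 0 < Rr -> exists w : R -> R, modulus w /\
  forall x y p q xi, I xi -> enorm p < Rr -> enorm q < Rr ->
    `|F x p xi - F y q xi| <= w (enorm (x - y) + enorm (p - q)).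
Hypothesis f_cont : forall xi, I xi -> continuous (fun x => f x xi).
Hypothesis f_bounded : exists M, forall x xi, I xi -> `|f x xi| <= M.
Hypothesis f_ge0 : forall x xi, I xi -> 0 <= f x xi.
Hypothesis u_Uplus : Uplus I u.
Hypothesis v_Uminus : Uminus I v.
Hypothesis u_sub : subsolution I F k f u.
Hypothesis v_super : supersolution I F k f v.
Hypothesis C_ge0 : 0 <= C.
Hypothesis u_le : forall x xi, I xi -> u x xi <= C.
Hypothesis v_le : forall x xi, I xi -> - v x xi <= C.
Hypothesis l_gt0 : 0 < l.
Hypothesis l_lt1 : l < 1.

Let gap (x : 'rV[R]_d) (eta : R) := l * u x eta - v x eta.

Let leb_Ifin : (leb I < +oo)%E. Proof. by rewrite leb_I ltry. Qed.

Let mkx xi : I xi -> measurable_fun (I : set T) (k xi : T -> R).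
Proof.
move=> Ixi.
apply: (@measurable_comp _ _ _ _ _ _ (I `*` I) (fun p : R * R => k p.1 p.2) I (pair xi)).
- exact: measurableX.
- by move=> _ [eta Ieta <-].
- exact: mk.
- by apply: measurable_funTS; exact: pair1_measurable.
Qed.

Let k_abs xi eta : I xi -> I eta -> `|k xi eta| <= k1.
Proof.
move=> Ixi Ieta; have [ge0 le1] := k_bound Ixi Ieta.
rewrite ger0_norm//; last first.
  by have := k0_gt0; lra.
Qed.

Let ik xi : I xi -> leb.-integrable I (EFin \o k xi).
Proof.
move=> Ixi; apply: (@integrable_bounded _ _ _ _ _ _ k1) => //; first exact: mkx.
by move=> eta; exact: k_abs.
Qed.

Let ikM xi (h : T -> R) : I xi -> leb.-integrable I (EFin \o h) ->
  leb.-integrable I (EFin \o (fun eta => k xi eta * h eta)).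
Proof.
move=> Ixi; apply: (@integrable_boundedM _ _ _ _ _ _ _ k1) => //; first exact: mkx.
by move=> eta; exact: k_abs.
Qed.

Let lu_le x xi : I xi -> l * u x xi <= C.
Proof.
move=> Ixi; apply: le_trans (ler_wpM2l (ltW l_gt0) (u_le x Ixi)) _.
by apply: ler_piMl => //; exact: ltW.
Qed.

Let iu x : leb.-integrable I (EFin \o u x).
Proof. exact: (u_Uplus.1 x).2. Qed.

Let iv x : leb.-integrable I (EFin \o v x).
Proof.
have := integrableN (v_Uminus.1 x).2.
by apply: eq_integrable => //= eta _; rewrite opprK.
Qed.

Let igap x y : leb.-integrable I (EFin \o (fun eta => l * u x eta - v y eta)).
Proof.
have := integrableB mI (integrableZl mI l (iu x)) (iv y).
exact: eq_integrable.
Qed.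

Let kappa xi := \int[leb]_(eta in I) k xi eta.

Let kappa_gt0 xi : I xi -> 0 < kappa xi.
Proof.
move=> Ixi; apply: lt_le_trans k0_gt0 _.
have i0 : leb.-integrable I (EFin \o cst k0).
  by apply: (@integrable_bounded _ _ _ _ _ _ `|k0|).
have := @le_Rintegral _ T R leb I (cst k0) (k xi) mI i0 (ik Ixi).
have -> : \int[leb]_(eta in I) cst k0 eta = k0.
  rewrite Rintegral_cst// -[RHS]mulr1; congr (_ * _).
  exact: (congr1 fine leb_I).
apply => eta Ieta.
by have [] := k_bound Ixi Ieta.
Qed.

(** Integrability makes the nonlocal term finite and splits it, turning the viscosity inequalities
    into real ones that can be subtracted. *)
Let nonlocalE (w : 'rV[R]_d -> R -> R) xi x : I xi -> leb.-integrable I (EFin \o w x) ->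
  nonlocal I k w x xi =
  (kappa xi * w x xi - \int[leb]_(eta in I) (k xi eta * w x eta))%:E.
Proof.
move=> Ixi iw.
have ikw := ikM Ixi iw.
have ikc : leb.-integrable I (EFin \o (fun eta => k xi eta * w x xi)).
  by have := integrableZr mI (w x xi) (ik Ixi); apply: eq_integrable.
have -> : kappa xi * w x xi = \int[leb]_(eta in I) (k xi eta * w x xi).
  by rewrite RintegralZr//; exact: ik.
rewrite -RintegralB// /Rintegral fineK; last first.
  apply: integrable_fin_num => //.
  by have := integrableB mI ikc ikw; apply: eq_integrable.
by apply: eq_integral => eta _; rewrite mulrBr.
Qed.

Let ikgap xi x y : I xi -> \int[leb]_(eta in I) (k xi eta * (l * u x eta - v y eta)) =
  l * \int[leb]_(eta in I) (k xi eta * u x eta) -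
  \int[leb]_(eta in I) (k xi eta * v y eta).
Proof.
move=> Ixi.
rewrite -RintegralZl//; last by apply: ikM.
rewrite -RintegralB//; last 2 first.
- by have := integrableZl mI l (ikM Ixi (iu x)); apply: eq_integrable.
- exact: ikM.
by apply: eq_Rintegral => eta _; ring.
Qed.

(** Joint in the pair: the doubled points differ, and the integral at [(x, y)] has to be compared
    with that at [(xh, xh)]. *)
Let usc_gap_integral xi : I xi -> upper_semicont (fun z : 'rV[R]_d * 'rV[R]_d =>
  \int[leb]_(eta in I) (k xi eta * (l * u z.1 eta - v z.2 eta))).
Proof.
move=> Ixi; apply: (@upper_semicont_Rintegral _ _ _ _ _ _ _ (k1 * (2 * C))) => //.
- by move=> z; apply: ikM.
- move=> z eta Ieta; have [? ?] := k_bound Ixi Ieta.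
  have vC := v_le z.2 Ieta; have uC := lu_le z.1 Ieta.
  have K0 : 0 <= k xi eta by apply: le_trans (ltW k0_gt0) _.
  apply: (@le_trans _ _ (k xi eta * (2 * C))); first by apply: ler_wpM2l => //; lra.
  by apply: ler_wpM2r => //; rewrite mulr_ge0.
- move=> eta Ieta; have [? ?] := k_bound Ixi Ieta.
  apply: upper_semicontZ; first exact: lt_le_trans k0_gt0 _.
  apply: upper_semicontD.
    apply: upper_semicontZ => //.
    apply: (@upper_semicont_comp _ _ _ (fun x => u x eta) fst).
      by move=> z; exact: cvg_fst.
    exact: (u_Uplus.2 _ Ieta).1.
  apply: (@upper_semicont_comp _ _ _ (fun x => - v x eta) snd).
    by move=> z; exact: cvg_snd.
  exact: (v_Uminus.2 _ Ieta).1.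
Qed.

(** As [m > 1], a norm above [1] is at most its [m]-th power, which coercivity bounds. *)
Let F_bounded_gradient B : exists2 P : R, 0 <= P &
  forall x p xi, I xi -> F x p xi <= B -> enorm p <= P.
Proof.
have [C1 [C2 [m [C10 [C20 [m1 Fge]]]]]] := F_coercive.
exists (Num.max 1 ((B + C2) / C1)); first by rewrite le_max ler01.
move=> x p xi Ixi FB; rewrite le_max.
have [//|p1] := leP (enorm p) 1; rewrite orFb.
have pm : enorm p <= enorm p `^ m by apply: le1r_powR; exact: ltW.
have := Fge x p xi Ixi; rewrite ler_pdivlMr//.
have := ler_wpM2l (ltW C10) pm; lra.
Qed.

(** At doubled points near [xh], subtract the supersolution inequality for [v] from [l] times the
    subsolution inequality for [u]. The gradient bound and the modulus of [F] are fixed before the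
    doubling chooses its parameter [n]; an arbitrary error [e] replaces the limit. *)
Lemma gap_max_inequality xi xh : I xi -> (forall x, gap x xi <= gap xh xi) ->
  \int[leb]_(eta in I) (k xi eta * (gap xh xi - gap xh eta)) <=
  - (1 - l) * f xh xi.
Proof.
move=> Ixi xhmax; set m := gap xh xi; set S := kappa xi.
pose J (z : 'rV[R]_d * 'rV[R]_d) :=
  \int[leb]_(eta in I) (k xi eta * (l * u z.1 eta - v z.2 eta)).
have -> : \int[leb]_(eta in I) (k xi eta * (m - gap xh eta)) = S * m - J (xh, xh).
  rewrite /S /kappa -RintegralZr//; last exact: ik.
  rewrite -RintegralB//; last 2 first.
  - by have := integrableZr mI m (ik Ixi); apply: eq_integrable.
  - exact: ikM.
  by apply: eq_Rintegral => eta _; rewrite mulrBr.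
apply/ler_addgt0Pr => e e0.
have S0 : 0 < S := kappa_gt0 Ixi.
(* The four quarters pay for [J], for [f] at [x], for [f] at [y] and for the modulus of [F]. *)
have e4 : 0 < e / 4 by lra.
have [Mf fM] := f_bounded.
(* This will bound [F x p xi]: the subsolution inequality gives at most
   [Mf + S * C - S * (l * u x xi)], and [l * u x xi >= m + v y xi >= m - C]. *)
have [P0 P0_ge0 gradP] := F_bounded_gradient (Mf + S * (2 * C - m)).
(* [q] differs from [p] by a vector of norm below [1], so the quasi-triangle inequality bounds its
   norm by [2 * (P0 + 1)]. *)
have Rr0 : 0 < 2 * (P0 + 1) + 1 by lra.
have [w [[w_ge0 [w_mono w_cvg]] Fw]] := F_modulus Rr0.
have [delta delta0 wdelta] : exists2 r : R, 0 < r & w r < e / 4.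
  have w4 : \forall r \near 0^'+, w r < e / 4.
    have /cvgrPdist_lt/(_ _ e4) := w_cvg; apply: filterS => r.
    by rewrite sub0r normrN => /ltr_normlW.
  have pos : \forall r \near (0 : R)^'+, 0 < r by exact: nbhs_right_gt.
  by have [r [wr r0]] := @filter_ex _ (0 : R)^'+ _ _ (filterI w4 pos); exists r.
have nP : \forall z \near (xh, xh), [/\ J z < J (xh, xh) + e / 4,
    `|f xh xi - f z.1 xi| < e / 4, `|f xh xi - f z.2 xi| < e / 4,
    enorm (z.1 - z.2) < delta / 2 &
    enorm (dpsi (z.1 - xh)) < Num.min 1 (delta / 2)].
  have d2 : 0 < delta / 2 by lra.
  have fe : \forall x \near xh, `|f xh xi - f x xi| < e / 4.
    by have /cvgrPdist_lt/(_ _ e4) := @f_cont xi Ixi xh.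
  have c1 : continuous (fun z : 'rV[R]_d * 'rV[R]_d => enorm (z.1 - z.2)).
    move=> z; apply: (@continuous_comp _ _ _
      (fun z : 'rV[R]_d * 'rV[R]_d => z.1 - z.2) enorm); last exact: continuous_enorm.
    by apply: cvgB; [exact: cvg_fst|exact: cvg_snd].
  have c2 : continuous (fun z : 'rV[R]_d * 'rV[R]_d => enorm (dpsi (z.1 - xh))).
    move=> z; apply: (@continuous_comp _ _ _
      (fun z : 'rV[R]_d * 'rV[R]_d => z.1 - xh)
      (fun y => enorm (dpsi y))); last exact: continuous_enorm_dpsi.
    by apply: cvgB; [exact: cvg_fst|exact: cvg_cst].
  have m0 : 0 < Num.min 1 (delta / 2) by rewrite lt_min ltr01.
  have h1 := @continuous_upper_semicont _ _ _ c1 (xh, xh) _ d2.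
  have h2 := @continuous_upper_semicont _ _ _ c2 (xh, xh) _ m0.
  rewrite /= subrr enorm0 add0r in h1; rewrite /= subrr dpsi0 enorm0 add0r in h2.
  near=> z; split.
  - by near: z; exact: usc_gap_integral.
  - by near: z; exact: (cvg_fst fe).
  - by near: z; exact: (cvg_snd fe).
  - by near: z; exact: h1.
  - by near: z; exact: h2.
have uscU : upper_semicont (fun x => l * u x xi).
  by apply: upper_semicontZ => //; exact: (u_Uplus.2 _ Ixi).1.
have [n [x [y [[Jz fx fy xy xxh] mle umax vmin]]]] :=
  doubling uscU (v_Uminus.2 _ Ixi).1 (fun x => lu_le x Ixi) (fun x => v_le x Ixi) xhmax nP.
rewrite /= in Jz fx fy xy xxh; rewrite -/(gap xh xi) -/m in mle.
pose q := n%:R *: dpsi (x - y).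
pose p := q + dpsi (x - xh).
have lV : l * l^-1 = 1 by rewrite mulfV// gt_eqF.
(* The penalty touches [l * u], so [u] is tested with [l^-1] times it. *)
have [C1u gradu] := C1_torus_psi (n%:R * l^-1) l^-1 y xh.
have := u_sub C1u Ixi (xh := x).
have -> : grad (fun x0 => n%:R * l^-1 * psi (x0 - y) + l^-1 * psi (x0 - xh)) x = l^-1 *: p.
  by rewrite gradu /p /q scalerDr scalerA (mulrC n%:R).
rewrite (nonlocalE Ixi (iu x)) -EFinD lee_fin => /(_ _)/wrap[].
  apply: filterS umax => x' le; rewrite -(ler_pM2l l_gt0).
  have E z : l * (u z xi - (n%:R * l^-1 * psi (z - y) + l^-1 * psi (z - xh))) =
      l * u z xi - n%:R * psi (z - y) - psi (z - xh).
    by field; rewrite gt_eqF.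
  by rewrite !E.
move=> s1.
have [C1v gradv] := C1_torus_psi (- n%:R) 0 x x.
have := v_super C1v Ixi (xh := y).
have -> : grad (fun x0 => - n%:R * psi (x0 - x) + 0 * psi (x0 - x)) y = q.
  by rewrite gradv scale0r addr0 /q -(opprB x y) dpsiN scalerN scaleNr opprK.
rewrite (nonlocalE Ixi (iv y)) -EFinD lee_fin => /(_ _)/wrap[].
  apply: filterS vmin => y'.
  by rewrite -(opprB x y) -(opprB x y') !psiN; lra.
move=> s2.
(* [p] is the convex combination of [l^-1 *: p] and [0] with weights [l] and [1 - l]. *)
have cvx : F x p xi <= l * F x (l^-1 *: p) xi.
  have := F_convex x (l^-1 *: p) 0 Ixi (ltW l_gt0) (ltW l_lt1).
  by rewrite scaler0 addr0 scalerA lV scale1r F0// mulr0 addr0.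
have Su : \int[leb]_(eta in I) (k xi eta * u x eta) * l <= S * C.
  rewrite -RintegralZr//; last exact: ikM.
  rewrite -[S * C]RintegralZr//; last exact: ik.
  apply: le_Rintegral => //.
  - by have := integrableZr mI l (ikM Ixi (iu x)); apply: eq_integrable.
  - by have := integrableZr mI C (ik Ixi); apply: eq_integrable.
  - move=> eta Ieta; rewrite -mulrA (mulrC (u _ _)); apply: ler_wpM2l.
      by have [? _] := k_bound Ixi Ieta; exact: le_trans (ltW k0_gt0) _.
    exact: lu_le.
rewrite -/S in s1 s2; have s1l := ler_wpM2l (ltW l_gt0) s1.
have lf : l * f x xi <= Mf.
  apply: (@le_trans _ _ (f x xi)); last exact: le_trans (ler_norm _) (fM _ _ Ixi).
  by apply: ler_piMl (ltW l_lt1); exact: f_ge0.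
have vC := v_le y Ixi.
have Fxp : F x p xi <= Mf + S * (2 * C - m).
  have Sm : S * (m - C) <= S * (l * u x xi) by apply: ler_wpM2l; lra.
  by lra.
have xxh1 : enorm (dpsi (x - xh)) < 1 by apply: lt_le_trans xxh _; rewrite ge_min lexx.
have xxh2 : enorm (dpsi (x - xh)) < delta / 2.
  by apply: lt_le_trans xxh _; rewrite ge_min lexx orbT.
have pP := gradP _ _ _ Ixi Fxp.
have qP : enorm q < 2 * (P0 + 1) + 1.
  have := ler_enormD2 p (- dpsi (x - xh)); rewrite addrK enormN; lra.
have pR : enorm p < 2 * (P0 + 1) + 1 by lra.
(* The doubling gradients cancel in [p - q]; only the localizing one, small near [xh], remains. *)
have := Fw x y p q xi Ixi pR qP.
rewrite [p - q](_ : _ = dpsi (x - xh)); last by rewrite /p addrAC subrr add0r.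
rewrite distrC => /(le_trans (ler_norm _)) Fqp.
have : w (enorm (x - y) + enorm (dpsi (x - xh))) <= w delta.
  by apply: w_mono; [rewrite addr_ge0// sqrtr_ge0|lra].
have Jxy : J (x, y) = l * \int[leb]_(eta in I) (k xi eta * u x eta) -
  \int[leb]_(eta in I) (k xi eta * v y eta) by exact: ikgap.
have Smle : S * m <= S * (l * u x xi - v y xi) by apply: ler_wpM2l; lra.
have lfx : l * f x xi <= l * (f xh xi + e / 4).
  by apply: ler_wpM2l; [exact: ltW|move: fx; rewrite ltr_norml => /andP[]; lra].
have le4 : l * (e / 4) <= e / 4 by apply: ler_piMl (ltW l_lt1); lra.
move: fy; rewrite ltr_norml => /andP[] fy1 fy2 wle.
lra.
Unshelve. all: by end_near. Qed.

(** * The supremum of [gap] and the zero set of [f] *)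

Let uscl_gap xi : I xi -> upper_semicont (gap^~ xi).
Proof.
move=> Ixi; apply: upper_semicontD; last exact: (v_Uminus.2 _ Ixi).1.
by apply: upper_semicontZ => //; exact: (u_Uplus.2 _ Ixi).1.
Qed.

Let gap_periodic xi : I xi -> Zd_periodic (gap^~ xi).
Proof.
move=> Ixi x i; rewrite /gap ((u_Uplus.2 _ Ixi).2 x i).
by have /oppr_inj -> := (v_Uminus.2 _ Ixi).2 x i.
Qed.

Let gap_le2C x xi : I xi -> gap x xi <= 2 * C.
Proof.
by move=> Ixi; have := lu_le x Ixi; have := v_le x Ixi; rewrite /gap; lra.
Qed.

Let gap_max xi : I xi ->
  exists2 xh, unit_cell xh & forall x, gap x xi <= gap xh xi.
Proof.
move=> Ixi.
have [xh cxh xhmax] := compact_upper_semicont_max (@compact_unit_cell R d)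
  (@unit_cell_neq0 R d)
  (uscl_gap Ixi) (fun x _ => gap_le2C x Ixi).
exists xh => // x; have [z cz xz] := unit_cell_representative x.
by rewrite (xz _ _ (gap_periodic Ixi)); exact: xhmax.
Qed.

(** The integral of [gap] over [I] is a single upper semicontinuous function of [x], so its maximum
    point [xb] depends on no [xi]; nearly maximal values of [gap] show that this maximum reaches
    [M]. *)
Let gap_integral_max (M : R) :
  (forall x xi, I xi -> gap x xi <= M) ->
  (forall e, 0 < e -> exists x xi, I xi /\ M - e < gap x xi) ->
  exists x, M <= \int[leb]_(eta in I) gap x eta.
Proof.
move=> gapM Msup.
have icst c : leb.-integrable I (EFin \o cst c).
  by apply: (@integrable_bounded _ _ _ _ _ _ `|c|).
have intcst c : \int[leb]_(eta in I) cst c eta = c.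
  rewrite Rintegral_cst// -[RHS]mulr1; congr (_ * _).
  exact: (congr1 fine leb_I).
have uscH : upper_semicont (fun x => \int[leb]_(eta in I) gap x eta).
  apply: (@upper_semicont_Rintegral _ _ _ _ _ _ _ (2 * C)) => //.
  by move=> x; exact: igap.
have HM x : \int[leb]_(eta in I) gap x eta <= M.
  rewrite -[leRHS]intcst; apply: le_Rintegral => //; first exact: igap.
  by move=> eta Ieta; exact: gapM.
have [xb _ xbmax] := compact_upper_semicont_max (@compact_unit_cell R d)
  (@unit_cell_neq0 R d)
  uscH (fun x _ => HM x).
exists xb; apply/ler_addgt0Pr => e e0.
have [_ [xi0 [Ixi0 _]]] := Msup 1 ltr01.
have k1_gt0 : 0 < k1.
  have [kk0 kk1] := k_bound Ixi0 Ixi0.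
  exact: lt_le_trans k0_gt0 (le_trans kk0 kk1).
(* Chosen so that [k1 * (M - m) <= e * k0]; dividing by [k0] at the end leaves [e]. *)
have ek : 0 < e * k0 / k1 by rewrite divr_gt0// mulr_gt0.
have [x1 [xi [Ixi Mx1]]] := Msup _ ek.
have [xh cxh xhmax] := gap_max Ixi.
have := gap_max_inequality Ixi xhmax.
set m := gap xh xi => key.
have key0 : \int[leb]_(eta in I) (k xi eta * (m - gap xh eta)) <= 0.
  apply: le_trans key _; rewrite mulNr oppr_le0 mulr_ge0 ?f_ge0//.
  by rewrite subr_ge0 ltW.
have imgap c : leb.-integrable I (EFin \o (fun eta => c - gap xh eta)).
  by have := integrableB mI (icst c) (igap xh xh); apply: eq_integrable.
(* Replace [k0] by [k xi eta], split [M - gap] as [(M - m) + (m - gap)], and bound [k] by [k1] in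
   the first term; the second has nonpositive integral. *)
have : \int[leb]_(eta in I) (k0 * (M - gap xh eta)) <=
       \int[leb]_(eta in I) (cst (k1 * (M - m)) eta + k xi eta * (m - gap xh eta)).
  apply: le_Rintegral => //.
  - by have := integrableZl mI k0 (imgap M); apply: eq_integrable.
  - by have := integrableD mI (icst (k1 * (M - m))) (ikM Ixi (imgap m));
      apply: eq_integrable.
  - move=> eta Ieta /=; have [kk0 kk1] := k_bound Ixi Ieta.
    have a1 : k0 * (M - gap xh eta) <= k xi eta * (M - gap xh eta).
      by apply: ler_wpM2r => //; rewrite subr_ge0 gapM.
    have a2 : k xi eta * (M - m) <= k1 * (M - m).
      by apply: ler_wpM2r => //; rewrite subr_ge0 gapM.
    by lra.
rewrite (RintegralZl k0 mI (imgap M)) (RintegralB mI (icst M) (igap xh xh)).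
rewrite intcst (RintegralD mI (icst (k1 * (M - m))) (ikM Ixi (imgap m))).
rewrite intcst => le1.
have Mm : k1 * (M - m) <= e * k0.
  have := xhmax x1; rewrite -/m => x1m.
  rewrite mulrC -ler_pdivlMr//; lra.
have := xbmax xh cxh => xhb.
have : k0 * (M - \int[leb]_(eta in I) gap xh eta) <= k0 * e by lra.
rewrite ler_pM2l// lerBlDl => le2.
exact: le_trans le2 (lerD xhb (lexx e)).
Qed.

Lemma gap_le :
  (forall x xi, Zset I f (x, xi) -> u x xi <= v x xi) ->
  forall x xi, I xi -> gap x xi <= (1 - l) * C.
Proof.
move=> uvZ x0 xi0 Ixi0.
pose G := [set r | exists x xi, I xi /\ r = gap x xi].
have hG : has_sup G.
  split; first by exists (gap x0 xi0), x0, xi0.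
  by exists (2 * C) => _ [x [xi [Ixi ->]]]; exact: gap_le2C.
set M := sup G.
have gapM x xi : I xi -> gap x xi <= M.
  by move=> Ixi; apply: (ub_le_sup hG.2); exists x, xi.
have Msup e : 0 < e -> exists x xi, I xi /\ M - e < gap x xi.
  move=> e0; have [_ [x [xi [Ixi ->]]] lt] := sup_adherent e0 hG.
  by exists x, xi.
apply: le_trans (gapM _ _ Ixi0) _.
have [xb Mxb] := gap_integral_max gapM Msup.
have icst c : leb.-integrable I (EFin \o cst c).
  by apply: (@integrable_bounded _ _ _ _ _ _ `|c|).
have iB : leb.-integrable I (EFin \o (fun eta => M - gap xb eta)).
  by have := integrableB mI (icst M) (igap xb xb); apply: eq_integrable.
have int0 : \int[leb]_(eta in I) (M - gap xb eta) = 0.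
  apply/eqP; rewrite eq_le; apply/andP; split; last first.
    by apply: Rintegral_ge0 => eta Ieta; rewrite subr_ge0 gapM.
  rewrite (RintegralB mI (icst M) (igap xb xb)) Rintegral_cst//.
  have -> : M * fine (leb I) = M by rewrite -[RHS]mulr1; congr (_ * _); exact: (congr1 fine leb_I).
  by rewrite subr_le0.
have aeM : {ae leb, forall eta, I eta -> gap xb eta = M}.
  have mB := measurable_int _ iB.
  have abs0 : (\int[leb]_(eta in I) `|(M - gap xb eta)%R%:E| = 0)%E.
    rewrite -[RHS]/((0 : R)%:E) -int0 /Rintegral fineK; last exact: integrable_fin_num.
    apply: eq_integral => eta; rewrite inE => Ieta.
    by rewrite abse_EFin ger0_norm// subr_ge0 gapM.
  have [+ _] := ae_eq_integral_abs leb mI mB.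
  move=> /(_ abs0); apply: filterS => eta h Ieta.
  by have [] := h Ieta; lra.
(* Where [gap xb eta = M], [xb] is a global maximum point for that [eta]. The integral in the
   inequality is then nonnegative, so [(1 - l) * f xb eta <= 0]. *)
have fM eta : I eta -> gap xb eta = M -> f xb eta = 0.
  move=> Ieta gM.
  have := @gap_max_inequality eta xb Ieta; rewrite gM => /(_ (fun x => gapM x eta Ieta)).
  move=> le1; apply/eqP; rewrite eq_le f_ge0// andbT.
  have ge1 : 0 <= \int[leb]_(t in I) (k eta t * (M - gap xb t)).
    apply: Rintegral_ge0 => t It; apply: mulr_ge0; last by rewrite subr_ge0 gapM.
    by have [? _] := k_bound Ieta It; exact: le_trans (ltW k0_gt0) _.
  have := le_trans ge1 le1; rewrite mulNr oppr_ge0 pmulr_rle0//.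
  by rewrite subr_gt0.
have xbA : Atilde I f xb.
  apply: (filterS (F := almost_everywhere (leb : {measure set T -> \bar R})) _ aeM) => eta h Ieta.
  by apply: fM => //; exact: h.
(* A set of measure [1] is not negligible, so equality almost everywhere holds somewhere. *)
have [eta Ieta gM] : exists2 eta, I eta & gap xb eta = M.
  apply: contrapT => noeta.
  have : leb.-negligible I.
    apply: negligibleS aeM => eta Ieta /= /(_ Ieta) gM; apply: noeta.
    by exists eta.
  move=> /(negligibleP _ mI) lI0.
  have : 1%E = 0 :> \bar R by rewrite -leb_I; exact: lI0.
  by move=> [/eqP]; rewrite oner_eq0.
have uv : u xb eta <= v xb eta by apply: uvZ; split => //=; split => //; exact: fM.
have vC := v_le xb Ieta.
have l10 : 0 < 1 - l by rewrite subr_gt0.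
(* [-v <= C] gives [l * u >= M - C], and [u <= v] gives [M <= -(1 - l) * u]. Hence
   [l * M <= (1 - l) * (C - M)], that is [M <= (1 - l) * C]. *)
have : (1 - l) * (l * u xb eta) >= (1 - l) * (M - C).
  by apply: ler_wpM2l; [exact: ltW|rewrite -gM /gap; lra].
have : l * M <= l * (- (1 - l) * u xb eta).
  by apply: ler_wpM2l; [exact: ltW|rewrite -gM /gap; lra].
by lra.
Qed.

End comparison.

(** * Letting [l] tend to [1] *)

Theorem theorem4p2 (R : realType) (d : nat) (a : R) (bl br : bool)
  (k : R -> R -> R) (k0 k1 : R)
  (F : 'rV[R]_d -> 'rV[R]_d -> R -> R) (f : 'rV[R]_d -> R -> R)
  (u v : 'rV[R]_d -> R -> R) :
  let I := Iset a bl br in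
  (* k : I x I -> R Borel measurable, 0 < k0 <= k <= k1 *)
  measurable_fun (I `*` I) (fun p : R * R => k p.1 p.2) ->
  0 < k0 ->
  (forall xi eta, I xi -> I eta -> k0 <= k xi eta /\ k xi eta <= k1) ->
  (* F in C(T^d x R^d) (x) B(I), F(.,p,.) bounded *)
  (forall p xi, Zd_periodic (fun x => F x p xi)) ->
  (forall xi, I xi -> continuous (fun xp : 'rV[R]_d * 'rV[R]_d => F xp.1 xp.2 xi)) ->
  (forall x p, measurable_fun I (F x p)) ->
  (forall p, exists M, forall x xi, I xi -> `|F x p xi| <= M) ->
  (* f in C(T^d) (x) B(I), bounded *)
  (forall xi, Zd_periodic (fun x => f x xi)) ->
  (forall xi, I xi -> continuous (fun x => f x xi)) ->
  (forall x, measurable_fun I (f x)) ->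
  (exists M, forall x xi, I xi -> `|f x xi| <= M) ->
  (* (A1) *)
  (exists C1 C2 m : R, 0 < C1 /\ 0 < C2 /\ 1 < m /\
     forall x p xi, I xi -> C1 * (enorm p `^ m) - C2 <= F x p xi) ->
  (* (A2) *)
  (forall x xi, I xi -> 0 <= f x xi) ->
  (exists x, forall xi, I xi -> f x xi = 0) ->
  (* (A3) *)
  (forall x xi p q (t : R), I xi -> 0 <= t -> t <= 1 ->
     F x (t *: p + (1 - t) *: q) xi <= t * F x p xi + (1 - t) * F x q xi) ->
  (* (A4) *)
  (forall x p xi, I xi -> 0 <= F x p xi) ->
  (forall x xi, I xi -> F x 0 xi = 0) ->
  (* (A5) *)
  (exists w : R -> R, modulus w /\
     forall x y xi, I xi -> `|f x xi - f y xi| <= w (enorm (x - y))) ->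
  (forall Rr : R, 0 < Rr -> exists w : R -> R, modulus w /\
     forall x y p q xi, I xi -> enorm p < Rr -> enorm q < Rr ->
       `|F x p xi - F y q xi| <= w (enorm (x - y) + enorm (p - q))) ->
  (* u, v *)
  Uplus I u -> Uminus I v ->
  subsolution I F k f u -> supersolution I F k f v ->
  (exists M, forall x xi, I xi -> u x xi <= M) ->
  (exists M, forall x xi, I xi -> - v x xi <= M) ->
  (forall x xi, Zset I f (x, xi) -> u x xi <= v x xi) ->
  forall x xi, I xi -> u x xi <= v x xi.
Proof.
move=> I mk k0_gt0 kb _ _ _ _ _ fc _ fb Fc fge0 _ Fconv _ F0 _ Fmod uU vU usub
  vsuper [Mu uM] [Mv vM] uvZ x xi Ixi.
(* A nonnegative [C] bounds [l * u] as well as [u]. *)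
pose C := Num.max 0 (Num.max Mu Mv).
have C0 : 0 <= C by rewrite le_max lexx.
have uC y eta : I eta -> u y eta <= C.
  by move=> Ieta; rewrite !le_max uM// orbT.
have vC y eta : I eta -> - v y eta <= C.
  by move=> Ieta; rewrite !le_max vM// !orbT.
have mI : measurable (I : set (measurableTypeR R)) by exact: measurable_itv.
have leb_I : leb I = 1%E.
  rewrite /leb /I /Iset.
  rewrite lebesgue_measure_itv/= lte_fin ltrDl ltr01 -EFinB.
  by rewrite addrAC subrr add0r.
apply/ler_addgt0Pr => e e0.
(* With [l = 1 - t], [u - v = gap + t * u <= 2 * t * C <= e]. The cap [2^-1] keeps [l] positive, and
   the [+ 1] covers [C = 0]. *)
pose t := Num.min 2^-1 (e / (2 * C + 1)).
have C1 : 0 < 2 * C + 1 by lra.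
have t0 : 0 < t by rewrite lt_min invr_gt0 ltr0n divr_gt0.
have t1 : t <= 2^-1 by rewrite ge_min lexx.
have te : t * (2 * C + 1) <= e by rewrite -ler_pdivlMr// ge_min lexx orbT.
have l0 : 0 < 1 - t by lra.
have l1 : 1 - t < 1 by lra.
have := gap_le mI leb_I mk k0_gt0 kb Fc Fconv F0 Fmod fc fb fge0 uU vU usub
  vsuper C0 uC vC l0 l1 uvZ x Ixi.
have := ler_wpM2l (ltW t0) (uC x xi Ixi).
by lra.
Qed.
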